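(* Fix $n\geq 2$. Then for any finite tuple $\bar a$ of elements of $\mathbb{F}_{n+1}$, the conjugacy class $[e_{n+1}]_{E_1}$ is not interalgebraic with $\bar a$ over $\mathbb{F}_n$, i.e. it is not the case that both $\bar a\in acl^{eq}(\mathbb{F}_n\cup\{[e_{n+1}]_{E_1}\})$ and $[e_{n+1}]_{E_1}\in acl^{eq}(\mathbb{F}_n\cup\bar a)$.
   Context: $\mathbb{F}_\omega$ is the free group with basis $e_1,e_2,\ldots$ and $\mathbb{F}_k=\langle e_1,\ldots,e_k\rangle$. $E_1$ is the equivalence relation of conjugacy, and $[x]_{E_1}$ is the conjugacy class of $x$ viewed as an imaginary element. Algebraic closure is computed in the eq-expansion $\mathbb{M}^{eq}$ of a saturated model $\mathbb{M}$ of the theory of non-abelian free groups (language $(\cdot,{}^{-1},1)$) having $\mathbb{F}_2\prec\mathbb{F}_3\prec\cdots\prec\mathbb{F}_\omega$ as elementary substructures; $\mathbb{M}^{eq}$ adds a sort of classes for each $\emptyset$-definable equivalence relation, and $acl^{eq}(A)$ is the set of elements of $\mathbb{M}^{eq}$ in a finite $A$-definable set. *)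

(* Defs.v *)
From mathcomp Require Import all_boot.
From mathcomp Require Import boolp classical_sets functions cardinality.

Set Implicit Arguments.
Unset Strict Implicit.
Unset Printing Implicit Defensive.

Local Open Scope classical_set_scope.
Local Open Scope card_scope.
Local Open Scope group_scope.

(** * First-order logic in the language (·, ⁻¹, 1) *)

(* [term n] and [formula n] have their free variables among the n variables
   indexed by 'I_n; variable 0 of the body of [FAll] is the bound one. *)
Inductive term (n : nat) : Type :=
| TVar of 'I_n
| TOne
| TMul of term n & term n
| TInv of term n.

Arguments TOne {n}.

Inductive formula : nat -> Type :=
| FEq n : term n -> term n -> formula n
| FFalse n : formula n
| FImp n : formula n -> formula n -> formula n
| FAll n : formula n.+1 -> formula n.

Arguments FFalse {n}.

Section Satisfaction.
Variable G : groupType.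

Definition scons n (x : G) (v : 'I_n -> G) : 'I_n.+1 -> G :=
  fun i => if unlift ord0 i is Some j then v j else x.

Fixpoint teval n (v : 'I_n -> G) (t : term n) : G :=
  match t with
  | TVar i => v i
  | TOne => 1
  | TMul t1 t2 => teval v t1 * teval v t2
  | TInv t1 => (teval v t1)^-1
  end.

(* Satisfaction in the substructure of G with universe D: it is only meant for
   subgroups D and assignments v with values in D. [sat setT] is satisfaction
   in G itself. *)
Fixpoint sat (D : set G) n (phi : formula n) : ('I_n -> G) -> Prop :=
  match phi in formula n return ('I_n -> G) -> Prop with
  | FEq _ t u => fun v => teval v t = teval v u
  | FFalse _ => fun _ => False
  | FImp _ phi1 phi2 => fun v => sat D phi1 v -> sat D phi2 v
  | FAll _ phi1 => fun v => forall x, D x -> sat D phi1 (scons x v)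
  end.

Definition is_subgroup (H : set G) : Prop :=
  [/\ H 1, forall x y, H x -> H y -> H (x * y) & forall x, H x -> H x^-1].

Definition elementary_sub (D D' : set G) : Prop :=
  [/\ is_subgroup D, is_subgroup D', D `<=` D' &
      forall n (phi : formula n) (v : 'I_n -> G),
        (forall i, D (v i)) -> (sat D phi v <-> sat D' phi v)].

Definition generated (A : set G) : set G :=
  [set x | forall H, is_subgroup H -> A `<=` H -> H x].

(* A letter (i, b) stands for e_i if b = false and for e_i⁻¹ if b = true. *)
Definition word_eval (I : Type) (e : I -> G) (w : seq (I * bool)) : G :=
  foldr (fun l g => (if l.2 then (e l.1)^-1 else e l.1) * g) 1 w.

End Satisfaction.

Definition reduced (I : Type) (w : seq (I * bool)) : Prop :=
  forall u v i b, w <> u ++ (i, b) :: (i, ~~ b) :: v.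

Definition free_basis (G : groupType) (H : set G) (I : Type) (e : I -> G)
    : Prop :=
  H = generated (range e) /\
  forall w : seq (I * bool), reduced w -> w <> [::] -> word_eval e w <> 1.

Definition nonabelian_free (G : groupType) : Prop :=
  (exists (I : Type) (e : I -> G), free_basis [set: G] e) /\
  (exists x y : G, x * y <> y * x).

Definition free_theory : set (formula 0) :=
  [set phi | forall G : groupType, nonabelian_free G ->
     forall v : 'I_0 -> G, sat setT phi v].

Definition models (M : groupType) (T : set (formula 0)) : Prop :=
  forall phi, T phi -> forall v : 'I_0 -> M, sat setT phi v.

(** * Saturation *)

Section Saturation.
Variable M : groupType.

(* A formula in the single variable 0, the other variables being replaced by
   the parameters [pf_par]. *)
Record pformula := PFormula {
  pf_n : nat;
  pf_body : formula pf_n.+1;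
  pf_par : 'I_pf_n -> M
}.

Definition pf_over (A : set M) (p : pformula) : Prop :=
  forall i, A (pf_par (p := p) i).

Definition psat (p : pformula) (x : M) : Prop :=
  sat setT (pf_body p) (scons x (pf_par (p := p))).

Definition finitely_satisfiable (P : set pformula) : Prop :=
  forall Q, finite_set Q -> Q `<=` P ->
    exists x, forall p, Q p -> psat p x.

(* [~ ([set: M] #<= A)] says |A| < |M|. *)
Definition saturated : Prop :=
  forall A : set M, ~ ([set: M] #<= A) ->
  forall P : set pformula, (forall p, P p -> pf_over A p) ->
    finitely_satisfiable P -> exists x, forall p, P p -> psat p x.

End Saturation.

(** * The eq-expansion of M *)

Section Eq.
Variable M : groupType.

Definition joinv k (x y : 'I_k -> M) : 'I_(k + k) -> M :=
  fun i => match fintype.split i with inl j => x j | inr j => y j end.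

Record def_equiv := DefEquiv {
  de_ar : nat;
  de_rel : ('I_de_ar -> M) -> ('I_de_ar -> M) -> Prop;
  de_refl : forall x, de_rel x x;
  de_sym : forall x y, de_rel x y -> de_rel y x;
  de_trans : forall x y z, de_rel x y -> de_rel y z -> de_rel x z;
  de_def : exists phi : formula (de_ar + de_ar),
    forall x y, de_rel x y <-> sat setT phi (joinv x y)
}.

Inductive eqsort : Type := Home | Quot of def_equiv.

Definition eq_class (E : def_equiv) : Type :=
  {C : set ('I_(de_ar E) -> M) | exists x, C = [set y | de_rel (d := E) x y]}.

Definition proj (E : def_equiv) (x : 'I_(de_ar E) -> M) : eq_class E :=
  exist _ [set y | de_rel (d := E) x y] (ex_intro _ x erefl).

Definition eqcarrier (s : eqsort) : Type :=
  match s with Home => M | Quot E => eq_class E end.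

(* A variable of sort s in a context, i.e. a list of sorts. *)
Inductive eqvar : seq eqsort -> eqsort -> Type :=
| VZ s c : eqvar (s :: c) s
| VS s s' c : eqvar c s -> eqvar (s' :: c) s.

Inductive eqterm (c : seq eqsort) : eqsort -> Type :=
| QVar s : eqvar c s -> eqterm c s
| QOne : eqterm c Home
| QMul : eqterm c Home -> eqterm c Home -> eqterm c Home
| QInv : eqterm c Home -> eqterm c Home
| QProj (E : def_equiv) :
    ('I_(de_ar E) -> eqterm c Home) -> eqterm c (Quot E).

Inductive eqformula : seq eqsort -> Type :=
| QEq c s : eqterm c s -> eqterm c s -> eqformula c
| QFalse c : eqformula c
| QImp c : eqformula c -> eqformula c -> eqformula c
| QAll c s : eqformula (s :: c) -> eqformula c.

Fixpoint eqenv (c : seq eqsort) : Type :=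
  if c is s :: c' then (eqcarrier s * eqenv c')%type else unit.

Fixpoint lookup c s (i : eqvar c s) : eqenv c -> eqcarrier s :=
  match i in eqvar c s return eqenv c -> eqcarrier s with
  | VZ _ _ => fun r => r.1
  | VS _ _ _ j => fun r => lookup j r.2
  end.

Fixpoint eqteval c (r : eqenv c) s (t : eqterm c s) : eqcarrier s :=
  match t in eqterm _ s return eqcarrier s with
  | QVar _ i => lookup i r
  | QOne => (1 : M)
  | QMul t1 t2 => (eqteval r t1 : M) * (eqteval r t2 : M)
  | QInv t1 => (eqteval r t1 : M)^-1
  | QProj _ ts => proj (fun i => eqteval r (ts i))
  end.

Fixpoint eqsat c (phi : eqformula c) : eqenv c -> Prop :=
  match phi in eqformula c return eqenv c -> Prop with
  | QEq _ _ t u => fun r => eqteval r t = eqteval r u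
  | QFalse _ => fun _ => False
  | QImp _ phi1 phi2 => fun r => eqsat phi1 r -> eqsat phi2 r
  | QAll _ s phi1 => fun r => forall x : eqcarrier s, eqsat phi1 (x, r)
  end.

Definition eqelt : Type := {s : eqsort & eqcarrier s}.

Fixpoint env_in (A : set eqelt) (c : seq eqsort) : eqenv c -> Prop :=
  match c return eqenv c -> Prop with
  | [::] => fun _ => True
  | s :: c' => fun r => A (existT eqcarrier s r.1) /\ env_in A r.2
  end.

Definition definable_over (A : set eqelt) (s : eqsort) (X : set (eqcarrier s))
    : Prop :=
  exists (c : seq eqsort) (phi : eqformula (s :: c)) (r : eqenv c),
    env_in A r /\ X = [set x | eqsat phi (x, r)].

Definition acleq (A : set eqelt) : set eqelt :=
  [set b | exists X : set (eqcarrier (projT1 b)),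
     [/\ definable_over A X, finite_set X & X (projT2 b)]].

Definition real (x : M) : eqelt := existT eqcarrier Home x.

Definition conj_rel (x y : 'I_1 -> M) : Prop :=
  exists g : M, y ord0 = x ord0 ^ g.

Lemma conj_rel_refl x : conj_rel x x.
Proof. by exists 1; rewrite conjg1. Qed.

Lemma conj_rel_sym x y : conj_rel x y -> conj_rel y x.
Proof. by case=> g yE; exists g^-1; rewrite yE conjgK. Qed.

Lemma conj_rel_trans x y z : conj_rel x y -> conj_rel y z -> conj_rel x z.
Proof. by case=> g yE [h zE]; exists (g * h); rewrite conjgM -yE. Qed.

(* ¬ ∀ g, ¬ (y = g⁻¹ (x g)), with g, x, y the variables 0, 1, 2. *)
Definition conj_formula : formula (1 + 1) :=
  let g := TVar (Ordinal (isT : 0 < 3)) in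
  let x := TVar (Ordinal (isT : 1 < 3)) in
  let y := TVar (Ordinal (isT : 2 < 3)) in
  FImp (FAll (FImp (FEq y (TMul (TInv g) (TMul x g))) FFalse)) FFalse.

Lemma conj_rel_def : exists phi : formula (1 + 1),
  forall x y, conj_rel x y <-> sat setT phi (joinv x y).
Proof.
exists conj_formula => x y.
have E0 g : scons g (joinv x y) (Ordinal (isT : 0 < 3)) = g.
  by rewrite /scons; case: unliftP => // j /(congr1 val).
have E1 g : scons g (joinv x y) (Ordinal (isT : 1 < 3)) = x ord0.
  rewrite /scons; case: unliftP => [j|] /(congr1 val) //= [jE].
  rewrite /joinv; case: fintype.splitP => [k _|k]; first by rewrite (ord1 k).
  by move=> jk; move: jE; rewrite jk.
have E2 g : scons g (joinv x y) (Ordinal (isT : 2 < 3)) = y ord0.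
  rewrite /scons; case: unliftP => [j|] /(congr1 val) //= [jE].
  rewrite /joinv; case: fintype.splitP => [k|k _]; last by rewrite (ord1 k).
  by move=> jk; move: jE; rewrite jk (ord1 k).
rewrite /conj_formula /=; split.
  by case=> g yE /(_ g I); apply; rewrite E0 E1 E2 yE.
move=> H; apply: contrapT => N; apply: H => g _.
by rewrite E0 E1 E2 => yE; apply: N; exists g.
Qed.

Definition E1 : def_equiv :=
  DefEquiv conj_rel_refl conj_rel_sym conj_rel_trans conj_rel_def.

Definition conj_class (x : M) : eqelt :=
  existT eqcarrier (Quot E1) (proj (E := E1) (fun _ => x)).

End Eq.

(** * The chain F_2 ≺ F_3 ≺ ... ≺ F_ω ≺ M *)

(* Indices are shifted by one: [e i] is the basis element e_{i+1}, so that
   [Fk e k] is generated by e_1, ..., e_k. *)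
Definition Fk (M : groupType) (e : nat -> M) (k : nat) : set M :=
  generated [set e i | i in [set i | (i < k)%N]].

Definition Fomega (M : groupType) (e : nat -> M) : set M :=
  generated (range e).

Record ambient_model (M : groupType) (e : nat -> M) : Prop := AmbientModel {
  am_theory : models M free_theory;
  am_saturated : saturated M;
  am_basis : free_basis (Fomega e) e;
  am_chain : forall k, (2 <= k)%N -> elementary_sub (Fk e k) (Fk e k.+1);
  am_chain_omega : forall k, (2 <= k)%N -> elementary_sub (Fk e k) (Fomega e);
  am_elementary : elementary_sub (Fomega e) [set: M]
}.

(* Main.v *)
(* Let F be the free group on e_1, e_2, ..., an elementary substructure of M.
   Formulas of M^eq translate to formulas of M on representatives, so an element
   with a representative in F that is algebraic over A has only finitely many
   images under the automorphisms of F that fix A.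

   For k > n+1 let s_k be the automorphism of F that replaces e_{n+1} by its
   conjugate by e_k.  It fixes F_n and the class of e_{n+1}, so if a in F_{n+1}
   is algebraic over these, then s_j(a) = s_k(a) for some j <> k.  Map F to the
   wreath product of M by itself by sending e_k to a nontrivial element of the
   top group, e_j to 1 and each remaining e_i to the copy of e_i in the factor
   of index 1 of the base group.  The conjugate of e_{n+1} by e_k goes to
   another factor and that by e_j does not.  Comparing the factors of index 1 of
   the images of s_j(a) and s_k(a), one finds that a is equal to the element
   obtained from it by deleting e_{n+1}.  Hence a is in F_n.

   It remains to see that the class of e_{n+1} is not algebraic over F_n:
   exchanging e_{n+1} with e_k fixes F_n, and distinct generators are not
   conjugate in M, since otherwise they would be conjugate in F, whereas an
   endomorphism of F can kill only one of them. *)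

Require Import Defs.
From HB Require Import structures.
From mathcomp Require Import all_boot.
From mathcomp Require Import boolp classical_sets functions cardinality.

Set Implicit Arguments.
Unset Strict Implicit.
Unset Printing Implicit Defensive.

Local Open Scope classical_set_scope.
Local Open Scope group_scope.

Lemma finite_set_inj (T U : Type) (J : set T) (X : set U) (f : T -> U) :
  finite_set X -> set_fun J X f -> set_inj J f -> finite_set J.
Proof.
move=> Xfin JX /inj_card_eq /eq_finite_set <-.
by apply: sub_finite_set Xfin; apply/image_subP.
Qed.

(** * Substitution and definable relations *)

Definition vcat (T : Type) k n (x : 'I_k -> T) (v : 'I_n -> T) :
    'I_(k + n) -> T :=
  fun i => match fintype.split i with inl j => x j | inr j => v j end.

Section Concatenation.
Variables (T : Type) (k n : nat).
Implicit Types (x : 'I_k -> T) (v : 'I_n -> T).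

Lemma vcat_lshift x v i : vcat x v (lshift n i) = x i.
Proof. by rewrite /vcat -[lshift n i]/(unsplit (inl i)) unsplitK. Qed.

Lemma vcat_rshift x v i : vcat x v (rshift k i) = v i.
Proof. by rewrite /vcat -[rshift k i]/(unsplit (inr i)) unsplitK. Qed.

Lemma vcat_all (P : set T) x v :
  (forall i, P (x i)) -> (forall i, P (v i)) -> forall i, P (vcat x v i).
Proof. by move=> Px Pv i; rewrite /vcat; case: fintype.split. Qed.

Lemma vcat_comp (U : Type) (f : T -> U) x v :
  vcat (f \o x) (f \o v) = f \o vcat x v.
Proof. by apply: funext => i /=; rewrite /vcat; case: fintype.split. Qed.

End Concatenation.

Lemma vcat0 (T : Type) n (x : 'I_0 -> T) (v : 'I_n -> T) : vcat x v = v.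
Proof.
apply: funext => i; have {1}-> : i = rshift 0 i by exact: val_inj.
exact: vcat_rshift.
Qed.

Section Assignments.
Variable G : groupType.

Lemma scons0 n (x : G) (v : 'I_n -> G) : scons x v ord0 = x.
Proof. by rewrite /scons unlift_none. Qed.

Lemma scons_lift n (x : G) (v : 'I_n -> G) i : scons x v (lift ord0 i) = v i.
Proof. by rewrite /scons liftK. Qed.

Lemma scons_eta n (w : 'I_n.+1 -> G) : scons (w ord0) (w \o lift ord0) = w.
Proof. by apply: funext => i; rewrite /scons; case: unliftP => [j|] ->. Qed.

Lemma scons_all (P : set G) n (x : G) (v : 'I_n -> G) :
  P x -> (forall i, P (v i)) -> forall i, P (scons x v i).
Proof. by move=> Px Pv i; rewrite /scons; case: unliftP. Qed.

Lemma scons_comp (h : G -> G) n (x : G) (v : 'I_n -> G) :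
  h \o scons x v = scons (h x) (h \o v).
Proof. by apply: funext => i; rewrite /= /scons; case: unliftP. Qed.

Lemma scons_vcat k n (x : G) (w : 'I_k -> G) (v : 'I_n -> G) :
  scons x (vcat w v) = vcat (scons x w) v.
Proof.
rewrite -[RHS](scons_eta (n := k + n)); congr scons.
  have -> : ord0 = lshift n ord0 :> 'I_(k.+1 + n) by exact: val_inj.
  by rewrite vcat_lshift scons0.
apply: funext => i; rewrite /= {1}/vcat; case: splitP => j ij.
  have -> : lift ord0 i = lshift n (lift ord0 j) :> 'I_(k.+1 + n).
    by apply: val_inj; rewrite /= ij.
  by rewrite vcat_lshift scons_lift.
have -> : lift ord0 i = rshift k.+1 j :> 'I_(k.+1 + n).
  by apply: val_inj; rewrite /= ij.
by rewrite vcat_rshift.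
Qed.

End Assignments.

Fixpoint tsubst n m (s : 'I_n -> term m) (t : term n) : term m :=
  match t with
  | TVar i => s i
  | TOne => TOne
  | TMul t1 t2 => TMul (tsubst s t1) (tsubst s t2)
  | TInv t1 => TInv (tsubst s t1)
  end.

Definition upsubst n m (s : 'I_n -> term m) : 'I_n.+1 -> term m.+1 :=
  fun i => if unlift ord0 i is Some j
           then tsubst (fun k => TVar (lift ord0 k)) (s j) else TVar ord0.

Fixpoint fsubst n (phi : formula n) : forall m, ('I_n -> term m) -> formula m :=
  match phi in formula n return forall m, ('I_n -> term m) -> formula m with
  | FEq _ t u => fun m s => FEq (tsubst s t) (tsubst s u)
  | FFalse _ => fun m s => FFalse
  | FImp _ phi1 phi2 => fun m s => FImp (fsubst phi1 s) (fsubst phi2 s)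
  | FAll _ phi1 => fun m s => FAll (fsubst phi1 (upsubst s))
  end.

Section Substitution.
Variable G : groupType.

Lemma teval_subst n m (s : 'I_n -> term m) (v : 'I_m -> G) t :
  teval v (tsubst s t) = teval (teval v \o s) t.
Proof. by elim: t => //= [t -> u ->|t ->]. Qed.

Lemma teval_upsubst n m (s : 'I_n -> term m) (x : G) (v : 'I_m -> G) :
  teval (scons x v) \o upsubst s = scons x (teval v \o s).
Proof.
apply: funext => i; rewrite /= /upsubst; case: unliftP => [j|] ->.
  rewrite scons_lift teval_subst; congr teval.
  by apply: funext => k /=; rewrite scons_lift.
by rewrite /= !scons0.
Qed.

Lemma sat_subst D n (phi : formula n) m (s : 'I_n -> term m) (v : 'I_m -> G) :
  sat D (fsubst phi s) v <-> sat D phi (teval v \o s).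
Proof.
elim: phi m s v => {n} [n t u|n|n p IHp q IHq|n p IHp] m s v //=.
- by rewrite !teval_subst.
- by rewrite IHp IHq.
by split=> p_all x /p_all; rewrite IHp teval_upsubst.
Qed.

Definition definable n (P : ('I_n -> G) -> Prop) : Prop :=
  exists phi : formula n, forall v, P v <-> sat setT phi v.

Lemma definable_forall1 n (P : ('I_n.+1 -> G) -> Prop) :
  definable P -> definable (fun v => forall x, P (scons x v)).
Proof.
by move=> [phi phiP]; exists (FAll phi) => v; split=> [Pv x _|Pv x];
  apply/phiP; exact: Pv.
Qed.

Lemma definable_forall k n (P : ('I_(k + n) -> G) -> Prop) :
  definable P -> definable (fun v => forall x : 'I_k -> G, P (vcat x v)).
Proof.
elim: k P => [|k IHk] P.
  move=> [phi phiP]; exists phi => v; rewrite -phiP; split=> [Pv|Pv x].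
    by have := Pv (v \o widen_ord (leq0n n)); rewrite vcat0.
  by rewrite vcat0.
move=> /(@definable_forall1 (k + n)) /IHk[phi phiP]; exists phi => v.
rewrite -phiP; split=> [Pv w x|Pv w]; first by rewrite scons_vcat; exact: Pv.
by rewrite -(scons_eta w) -scons_vcat; exact: Pv.
Qed.

End Substitution.

(** * Elimination of the imaginary sorts *)

Section EqElimination.
Variable M : groupType.

Lemma proj_eqP (E : def_equiv M) (x y : 'I_(de_ar E) -> M) :
  proj x = proj y <-> de_rel (d := E) x y.
Proof.
split=> [[xyE]|xy].
  have : [set z | de_rel (d := E) y z] y by exact: de_refl.
  by rewrite -xyE.
apply: eq_exist; apply/seteqP; split=> z /=; apply: de_trans => //.
exact: de_sym.
Qed.

Definition width (s : eqsort M) : nat := if s is Quot E then de_ar E else 1.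

Definition represented (s : eqsort M) : ('I_(width s) -> M) -> eqcarrier s :=
  match s return ('I_(width s) -> M) -> eqcarrier s with
  | Home => fun u => u ord0
  | Quot E => fun u => proj u
  end.

Fixpoint cwidth (c : seq (eqsort M)) : nat :=
  if c is s :: c' then (width s + cwidth c')%N else 0.

Fixpoint crepresented (c : seq (eqsort M)) : ('I_(cwidth c) -> M) -> eqenv c :=
  match c return ('I_(cwidth c) -> M) -> eqenv c with
  | [::] => fun _ => tt
  | s :: c' => fun v => (represented (v \o lshift (cwidth c')),
                         crepresented (v \o @rshift (width s) (cwidth c')))
  end.

Lemma represented_surj (s : eqsort M) (x : eqcarrier s) :
  exists u, represented u = x.
Proof.
case: s x => [x|E [C CE]]; first by exists (fun _ => x).
by case: (CE) => u Cu; exists u; apply: eq_exist.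
Qed.

Lemma crepresented_cat s c (u : 'I_(width s) -> M) (v : 'I_(cwidth c) -> M) :
  crepresented (c := s :: c) (vcat u v) = (represented u, crepresented v).
Proof.
by congr (represented _, crepresented _); apply: funext => i /=;
  rewrite (vcat_lshift, vcat_rshift).
Qed.

Lemma lookup_represented c s (i : eqvar c s) :
  exists f : 'I_(width s) -> 'I_(cwidth c),
    forall v, lookup i (crepresented v) = represented (v \o f).
Proof.
elim: i => {c s} [s c|s s' c i [f fP]]; first by exists (lshift (cwidth c)).
by exists (@rshift (width s') (cwidth c) \o f) => v /=; rewrite fP.
Qed.

Lemma eqteval_represented c s (t : eqterm c s) :
  exists ts : 'I_(width s) -> term (cwidth c),
    forall v, eqteval (crepresented v) t = represented (teval v \o ts).
Proof.
elim: t => {s} [s i||t [ts tP] u [us uP]|t [ts tP]|E t IHt].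
- by have [f fP] := lookup_represented i; exists (@TVar _ \o f) => v; exact: fP.
- by exists (fun _ => TOne).
- by exists (fun _ => TMul (ts ord0) (us ord0)) => v /=; rewrite tP uP.
- by exists (fun _ => TInv (ts ord0)) => v /=; rewrite tP.
have [ts tsP] := choice IHt.
by exists (ts^~ ord0) => v; congr proj; apply: funext => j; exact: tsP.
Qed.

Lemma definable_eqterm_eq c s (t u : eqterm c s) :
  definable (fun v => eqteval (crepresented v) t = eqteval (crepresented v) u).
Proof.
have [ts tP] := eqteval_represented t; have [us uP] := eqteval_represented u.
case: s t u ts tP us uP => [|E] t u ts tP us uP.
  by exists (FEq (ts ord0) (us ord0)) => v; rewrite tP uP.
have [phi phiP] := de_def E; exists (fsubst phi (vcat ts us)) => v.
by rewrite tP uP proj_eqP phiP sat_subst -vcat_comp.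
Qed.

Lemma definable_eqsat c (phi : eqformula c) :
  definable (fun v => eqsat phi (crepresented v)).
Proof.
elim: phi => {c} [c s t u|c|c p [p' pP] q [q' qP]|c s p IHp].
- exact: definable_eqterm_eq.
- by exists FFalse.
- by exists (FImp p' q') => v /=; rewrite pP qP.
have [psi psiP] := definable_forall IHp; exists psi => v.
rewrite -psiP; split=> [p_all u|p_all x].
  by rewrite crepresented_cat; exact: p_all.
have [u <-] := represented_surj x; rewrite -crepresented_cat; exact: p_all.
Qed.

End EqElimination.

(** * Morphisms on subgroups *)

Definition morph_on (G K : groupType) (H : set G) (f : G -> K) : Prop :=
  forall x y, H x -> H y -> f (x * y) = f x * f y.

Definition aut_on (G : groupType) (H : set G) (f : G -> G) : Prop :=
  morph_on H f /\ set_bij H H f.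

Lemma sub_morph_on (G K : groupType) (H H' : set G) (f : G -> K) :
  H `<=` H' -> morph_on H' f -> morph_on H f.
Proof. by move=> HH' fM x y /HH' Hx /HH'; exact: fM. Qed.

Lemma comp_morph_on (G K L : groupType) (H : set G) (H' : set K)
    (f : G -> K) (g : K -> L) :
  set_fun H H' f -> morph_on H f -> morph_on H' g -> morph_on H (g \o f).
Proof. by move=> fH fM gM x y Hx Hy /=; rewrite fM // gM //; exact: fH. Qed.

Lemma subgroupJ (G : groupType) (H : set G) x y :
  is_subgroup H -> H x -> H y -> H (x ^ y).
Proof.
by move=> [_ HM HV] Hx Hy; rewrite conjgE; apply/HM/HM => //; apply: HV.
Qed.

Section Morphisms.
Variables (G K : groupType) (H : set G) (f : G -> K).
Hypotheses (sH : is_subgroup H) (fM : morph_on H f).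

Lemma morph_on1 : f 1 = 1.
Proof. by have [H1 _ _] := sH; apply: (mulgI (f 1)); rewrite -fM // !mulg1. Qed.

Lemma morph_onV x : H x -> f x^-1 = (f x)^-1.
Proof.
have [_ _ HV] := sH => Hx; apply: (mulgI (f x)).
by rewrite -fM ?mulgV ?morph_on1 //; apply: HV.
Qed.

Lemma morph_onJ x y : H x -> H y -> f (x ^ y) = f x ^ f y.
Proof.
have [_ HM HV] := sH => Hx Hy.
by rewrite !conjgE !fM ?morph_onV //; [exact: HV|exact: HM].
Qed.

Lemma preimage_subgroup (B : set K) :
  is_subgroup B -> is_subgroup (H `&` f @^-1` B).
Proof.
move=> [B1 BM BV]; have [H1 HM HV] := sH.
split=> [|x y [Hx Bx] [Hy By]|x [Hx Bx]]; split=> //=.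
- by rewrite morph_on1.
- exact: HM.
- by rewrite fM //; exact: BM.
- exact: HV.
by rewrite morph_onV //; exact: BV.
Qed.

End Morphisms.

Lemma equalizer_subgroup (G K : groupType) (H : set G) (f g : G -> K) :
  is_subgroup H -> morph_on H f -> morph_on H g ->
  is_subgroup (H `&` [set x | f x = g x]).
Proof.
move=> sH fM gM; have [H1 HM HV] := sH.
split=> [|x y [Hx fgx] [Hy fgy]|x [Hx fgx]]; split=> //=.
- by rewrite (morph_on1 sH fM) (morph_on1 sH gM).
- exact: HM.
- by rewrite fM // gM // fgx fgy.
- exact: HV.
by rewrite (morph_onV sH fM) // (morph_onV sH gM) // fgx.
Qed.

Section Generated.
Variables (G : groupType) (A : set G).

Lemma generated_subgroup : is_subgroup (generated A).
Proof.
split=> [H [] //|x y Ax Ay H sH AH|x Ax H sH AH]; case: (sH) => _ HM HV.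
  by apply: HM; [exact: Ax|exact: Ay].
by apply: HV; exact: Ax.
Qed.

Lemma sub_generated : A `<=` generated A.
Proof. by move=> x Ax H _; apply. Qed.

Lemma generated_sub (H : set G) :
  is_subgroup H -> A `<=` H -> generated A `<=` H.
Proof. by move=> sH AH x; apply. Qed.

End Generated.

Lemma generatedS (G : groupType) (A B : set G) :
  A `<=` B -> generated A `<=` generated B.
Proof.
move=> AB; apply: generated_sub (generated_subgroup _) _.
exact: subset_trans AB (@sub_generated _ _).
Qed.

Lemma generated_set_fun (G K : groupType) (A : set G) (B : set K) (f : G -> K) :
  morph_on (generated A) f -> is_subgroup B -> set_fun A B f ->
  set_fun (generated A) B f.
Proof.
move=> fM sB AB x Ax.
have sP := preimage_subgroup (generated_subgroup A) fM sB.
have [] // := generated_sub sP _ Ax.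
by move=> y Ay; split; [exact: sub_generated|exact: AB].
Qed.

Lemma generated_morph_eq (G K : groupType) (A : set G) (f g : G -> K) :
  morph_on (generated A) f -> morph_on (generated A) g ->
  (forall x, A x -> f x = g x) -> forall x, generated A x -> f x = g x.
Proof.
move=> fM gM fg x Ax.
have sP := equalizer_subgroup (generated_subgroup A) fM gM.
have [] // := generated_sub sP _ Ax.
by move=> y Ay; split; [exact: sub_generated|exact: fg].
Qed.

(** * Free groups *)

Section Words.
Variables (G : groupType) (I : Type) (e : I -> G).

Lemma word_eval_cat u v :
  word_eval e (u ++ v) = word_eval e u * word_eval e v.
Proof. by elim: u => [|l u IHu] /=; rewrite ?mul1g // IHu mulgA. Qed.

Definition inv_word (w : seq (I * bool)) : seq (I * bool) :=
  rev [seq (l.1, ~~ l.2) | l <- w].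

Lemma word_eval_inv w : word_eval e (inv_word w) = (word_eval e w)^-1.
Proof.
elim: w => [|[i b] w IHw]; rewrite /inv_word /= ?invg1 //.
rewrite rev_cons -cats1 word_eval_cat -/(inv_word w) IHw invgM /= mulg1.
by case: b => //=; rewrite invgK.
Qed.

Lemma generated_word x : generated (range e) x -> exists w, word_eval e w = x.
Proof.
apply: (@generated_sub _ _ [set y | exists w, word_eval e w = y])
  => [|_ [i _ <-]].
  split=> [|y z [u <-] [v <-]|y [u <-]].
  - by exists [::].
  - by exists (u ++ v); rewrite word_eval_cat.
  by exists (inv_word u); rewrite word_eval_inv.
by exists [:: (i, false)]; rewrite /= mulg1.
Qed.

Lemma word_eval_cancel u v i b :
  word_eval e (u ++ (i, b) :: (i, ~~ b) :: v) = word_eval e (u ++ v).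
Proof.
by rewrite !word_eval_cat /=; case: b; rewrite /= ?mulKg ?mulVKg.
Qed.

End Words.

(* Outside the subgroup generated by e the value is 1, and if e is not a basis
   of it the function need not be a morphism. *)
Definition free_hom (G K : groupType) (I : choiceType) (e : I -> G)
    (f : I -> K) (x : G) : K :=
  word_eval f (xget [::] [set w | word_eval e w = x]).

Section FreeGroup.
Variables (G : groupType) (H : set G) (I : choiceType) (e : I -> G).
Hypothesis eH : free_basis H e.

Lemma free_basis_subgroup : is_subgroup H.
Proof. by case: eH => -> _; exact: generated_subgroup. Qed.

Let sH := free_basis_subgroup.

Lemma free_basis_mem i : H (e i).
Proof. by case: eH => -> _; apply: sub_generated; exists i. Qed.

Lemma free_basis_generated_sub A : generated (e @` A) `<=` H.
Proof. by apply: generated_sub sH _ => _ [i _ <-]; exact: free_basis_mem. Qed.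

Lemma free_basis_neq1 i : e i <> 1.
Proof.
have := proj2 eH [:: (i, false)]; rewrite /= mulg1; apply => //.
by move=> [|? [|? ?]].
Qed.

Lemma free_basis_word_eq1 (K : groupType) (f : I -> K) w :
  word_eval e w = 1 -> word_eval f w = 1.
Proof.
have [k] := ubnP (size w); elim: k w => // k IHk w.
have [->|w0] := pselect (w = [::]); first by [].
have [/(proj2 eH w) /(_ w0) //|] := pselect (reduced w).
move=> /existsNP[u] /existsNP[v] /existsNP[i] /existsNP[b] /contrapT ->.
rewrite !word_eval_cancel => wk; apply: IHk; move: wk.
by rewrite !size_cat /= !addnS ltnS => /ltnW.
Qed.

Lemma free_hom_word_eval (K : groupType) (f : I -> K) w :
  free_hom e f (word_eval e w) = word_eval f w.
Proof.
pose sameval := [set u | word_eval e u = word_eval e w].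
have /= xgetE : sameval (xget [::] sameval) by apply: xgetPex; exists w.
apply: divg1_eq; rewrite -word_eval_inv -word_eval_cat.
apply: free_basis_word_eq1; rewrite word_eval_cat word_eval_inv.
by rewrite xgetE mulgV.
Qed.

Lemma free_homE (K : groupType) (f : I -> K) i : free_hom e f (e i) = f i.
Proof.
by have := free_hom_word_eval f [:: (i, false)]; rewrite /= !mulg1.
Qed.

Lemma free_homM (K : groupType) (f : I -> K) : morph_on H (free_hom e f).
Proof.
case: eH => -> _ x y /generated_word[u <-] /generated_word[v <-].
by rewrite -word_eval_cat !free_hom_word_eval word_eval_cat.
Qed.

Lemma free_hom_set_fun (f : I -> G) :
  (forall i, H (f i)) -> set_fun H H (free_hom e f).
Proof.
move=> fH x; have [HE _] := eH; have fM := free_homM f.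
rewrite [X in X x -> _]HE; apply: generated_set_fun sH _ x.
  by rewrite -HE.
by move=> _ [i _ <-]; rewrite free_homE.
Qed.

Lemma free_basis_morph_eq (K : groupType) (f g : G -> K) :
  morph_on H f -> morph_on H g -> (forall i, f (e i) = g (e i)) ->
  forall x, H x -> f x = g x.
Proof.
have [-> _] := eH => fM gM fg; apply: generated_morph_eq => // _ [i _ <-].
exact: fg.
Qed.

Lemma free_hom_fix (f : I -> G) (A : set I) x :
  (forall i, A i -> f i = e i) -> generated (e @` A) x -> free_hom e f x = x.
Proof.
move=> fe; apply: (generated_morph_eq (g := id)) => //.
  exact: sub_morph_on (@free_basis_generated_sub A) (free_homM f).
by move=> _ [i Ai <-]; rewrite free_homE fe.
Qed.

Lemma free_hom_cancel (s t : I -> G) : (forall i, H (s i)) ->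
  (forall i, free_hom e t (s i) = e i) ->
  forall x, H x -> free_hom e t (free_hom e s x) = x.
Proof.
move=> Hs ts; apply: (@free_basis_morph_eq _ (free_hom e t \o free_hom e s) id).
- by apply: comp_morph_on (free_homM s) (free_homM t); exact: free_hom_set_fun.
- by [].
by move=> i; rewrite /= free_homE ts.
Qed.

Lemma free_hom_aut (s t : I -> G) :
  (forall i, H (s i)) -> (forall i, H (t i)) ->
  (forall i, free_hom e s (t i) = e i) ->
  (forall i, free_hom e t (s i) = e i) ->
  aut_on H (free_hom e s).
Proof.
move=> Hs Ht st ts; split; first exact: free_homM.
have sHH := free_hom_set_fun Hs; have tHH := free_hom_set_fun Ht.
have stK := free_hom_cancel Ht st; have tsK := free_hom_cancel Hs ts.
split=> // [x y /set_mem Hx /set_mem Hy sxy|y Hy].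
  by rewrite -[x]tsK // sxy tsK.
by exists (free_hom e t y); [exact: tHH|exact: stK].
Qed.

Lemma free_hom_perm_aut (s t : I -> I) :
  cancel s t -> cancel t s -> aut_on H (free_hom e (e \o s)).
Proof.
move=> sK tK.
apply: (free_hom_aut (t := e \o t)) => i; rewrite /= ?free_homE /=.
- exact: free_basis_mem.
- exact: free_basis_mem.
- by rewrite tK.
by rewrite sK.
Qed.

Lemma free_basis_conj_inj g i j : H g -> e i = e j ^ g -> i = j.
Proof.
move=> Hg ij; apply/eqP/negPn/negP => nij.
pose kill : G -> G := free_hom e (fwith i 1 e).
have := congr1 kill ij; rewrite /kill (morph_onJ sH (free_homM _)) //.
  rewrite !free_homE /= eqxx eq_sym (negPf nij) => /esym/eqP.
  by rewrite conjg_eq1 => /eqP; exact: free_basis_neq1.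
exact: free_basis_mem.
Qed.

End FreeGroup.

(** * Exchanges and partial conjugations of generators *)

Definition transposition (I : eqType) (i k : I) : I -> I :=
  fwith i k (fwith k i id).

Section Transposition.
Variables (I : eqType) (i k : I).

Lemma transpositionL : transposition i k i = k.
Proof. by rewrite /transposition /= eqxx. Qed.

Lemma transpositionD z : z != i -> z != k -> transposition i k z = z.
Proof. by rewrite /transposition /= => /negPf-> /negPf->. Qed.

Lemma transpositionK : involutive (transposition i k).
Proof.
move=> z; have [->|zi] := eqVneq z i.
  by rewrite transpositionL /transposition /= eqxx; case: eqVneq.
have [->|zk] := eqVneq z k; last by rewrite !transpositionD.
have -> : transposition i k k = i.
  by rewrite /transposition /= eqxx; case: eqVneq.
exact: transpositionL.
Qed.

End Transposition.

Definition partial_conj (G : groupType) (I : choiceType) (e : I -> G) (i : I)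
    (g : G) : G -> G :=
  free_hom e (fwith i (e i ^ g) e).

Section PartialConjugation.
Variables (G : groupType) (H : set G) (I : choiceType) (e : I -> G).
Hypothesis eH : free_basis H e.

Let sH := free_basis_subgroup eH.

Lemma partial_conjM i g : morph_on H (partial_conj e i g).
Proof. exact: free_homM. Qed.

Lemma partial_conj_basis i g : partial_conj e i g (e i) = e i ^ g.
Proof. by rewrite /partial_conj (free_homE eH) /= eqxx. Qed.

Lemma partial_conj_fix i g (A : set I) x :
  ~ A i -> generated (e @` A) x -> partial_conj e i g x = x.
Proof.
move=> niA; apply: (free_hom_fix eH) => z Az /=.
by case: eqP => // zi; case: niA; rewrite -zi.
Qed.

Lemma partial_conj_basis_neq i g k : k <> i -> partial_conj e i g (e k) = e k.
Proof.
by move/eqP=> ki; rewrite /partial_conj (free_homE eH) /= (negPf ki).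
Qed.

Lemma conj_basis_mem i g z : H g -> H (fwith i (e i ^ g) e z).
Proof.
move=> Hg /=; case: ifP => _; last exact: free_basis_mem eH z.
exact: subgroupJ sH (free_basis_mem eH i) Hg.
Qed.

Lemma partial_conj_set_fun i g : H g -> set_fun H H (partial_conj e i g).
Proof.
by move=> Hg; apply: (free_hom_set_fun eH) => z; exact: conj_basis_mem.
Qed.

Lemma partial_conjK i g h z :
  generated (e @` [set~ i]) h -> g * h = 1 ->
  partial_conj e i g (fwith i (e i ^ h) e z) = e z.
Proof.
move=> hi gh /=; have [->|/eqP zi] := eqVneq z i; last first.
  exact: partial_conj_basis_neq.
have ei := free_basis_mem eH i; have Hh := free_basis_generated_sub eH hi.
rewrite (morph_onJ sH (partial_conjM i g)) // partial_conj_basis.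
by rewrite (partial_conj_fix _ _ hi) -?conjgM ?gh ?conjg1 //; apply.
Qed.

Lemma partial_conj_aut i g :
  generated (e @` [set~ i]) g -> aut_on H (partial_conj e i g).
Proof.
move=> gi; have Hg := free_basis_generated_sub eH gi; have [_ _ HV] := sH.
have [_ _ giV] := generated_subgroup (e @` [set~ i]).
apply: (free_hom_aut eH (t := fwith i (e i ^ g^-1) e)) => z.
- exact: conj_basis_mem.
- by apply: conj_basis_mem; exact: HV.
- by apply: partial_conjK; rewrite ?mulgV //; exact: giV.
by apply: partial_conjK; rewrite ?mulVg.
Qed.

End PartialConjugation.

(** * The regular wreath product *)

(* The pair (k, p) stands for the product k p, where K acts on the base group of
   functions by (p ^ k)(l) = p (k l). *)
Definition wreath (G K : groupType) : Type := (K * (K -> G))%type.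

HB.instance Definition _ (G K : groupType) := Choice.on (wreath G K).

Section Wreath.
Variables G K : groupType.

Definition wreath_one : wreath G K := (1, fun=> 1).

Definition wreath_mul (x y : wreath G K) : wreath G K :=
  (x.1 * y.1, fun k => x.2 (y.1 * k) * y.2 k).

Definition wreath_inv (x : wreath G K) : wreath G K :=
  (x.1^-1, fun k => (x.2 (x.1^-1 * k))^-1).

Lemma wreath_mulA : associative wreath_mul.
Proof.
move=> x y z; rewrite /wreath_mul /= mulgA; congr pair.
by apply: funext => k; rewrite !mulgA.
Qed.

Lemma wreath_mul1g : left_id wreath_one wreath_mul.
Proof.
move=> [a p]; rewrite /wreath_mul /= mul1g; congr pair.
by apply: funext => k; rewrite mul1g.
Qed.

Lemma wreath_mulg1 : right_id wreath_one wreath_mul.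
Proof.
move=> [a p]; rewrite /wreath_mul /= mulg1; congr pair.
by apply: funext => k; rewrite mul1g mulg1.
Qed.

Lemma wreath_mulVg : left_inverse wreath_one wreath_inv wreath_mul.
Proof.
move=> x; rewrite /wreath_mul /= mulVg; congr pair.
by apply: funext => k; rewrite mulKg mulVg.
Qed.

Lemma wreath_mulgV : right_inverse wreath_one wreath_inv wreath_mul.
Proof.
move=> x; rewrite /wreath_mul /= mulgV; congr pair.
by apply: funext => k; rewrite mulgV.
Qed.

HB.instance Definition _ := isGroup.Build (wreath G K)
  wreath_mulA wreath_mul1g wreath_mulg1 wreath_mulVg wreath_mulgV.

Definition wreath_base : set (wreath G K) := [set x | x.1 = 1].

Lemma wreath_base_subgroup : is_subgroup wreath_base.
Proof.
rewrite /wreath_base; split=> [//|[a p] [b q] /= -> ->|[a p] /= ->].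
  exact: mulg1.
exact: invg1.
Qed.

Lemma wreath_baseJ (x y : wreath G K) : wreath_base x -> wreath_base (x ^ y).
Proof.
rewrite /wreath_base /= => xE.
exact: etrans (congr1 (conjg^~ y.1) xE) (conj1g _).
Qed.

Lemma wreath_coordM (k : K) : morph_on wreath_base (fun x => x.2 k).
Proof.
move=> x [b q]; rewrite /wreath_base /= => _ ->.
by congr (x.2 _ * q k); exact: mul1g.
Qed.

Definition wreath_top (k : K) : wreath G K := (k, fun=> 1).

Definition wreath_factor1 (g : G) : wreath G K :=
  (1, fun k => if k == 1 then g else 1).

Lemma wreath_factor1_conj_top g k :
  wreath_factor1 g ^ wreath_top k =
  (1, fun l => if k * l == 1 then g else 1) :> wreath G K.
Proof.
rewrite conjgE; congr pair; first by rewrite /= mul1g mulVg.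
by apply: funext => l /=; rewrite invg1 mul1g mulg1.
Qed.

End Wreath.

Section Separation.
Variables (G : groupType) (H : set G) (I : choiceType) (e : I -> G).
Hypothesis eH : free_basis H e.
Variables (A : set I) (i j k : I).
Hypotheses (niA : ~ A i) (njA : ~ (i |` A) j) (nkA : ~ (i |` A) k).
Hypothesis njk : j != k.

Let sH := free_basis_subgroup eH.
Let eHi := free_basis_mem eH.

Let partial_conj_basis_in g z : A z -> partial_conj e i g (e z) = e z.
Proof.
by move=> Az; apply: (partial_conj_basis_neq eH) => zi; apply: niA; rewrite -zi.
Qed.

Definition separator : G -> wreath G G :=
  free_hom e (fwith k (wreath_top G (e i))
               (fwith j 1 (fun z => wreath_factor1 G (e z)))).

Lemma separatorM : morph_on H separator.
Proof. exact: free_homM. Qed.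

Lemma separator_basis z : (i |` A) z ->
  separator (e z) = wreath_factor1 G (e z).
Proof.
move=> Az; rewrite /separator (free_homE eH) /=.
by case: eqP => [zk|_]; [|case: eqP => // zj]; subst z.
Qed.

Lemma separator_basis_j : separator (e j) = 1.
Proof. by rewrite /separator (free_homE eH) /= (negPf njk) eqxx. Qed.

Lemma separator_basis_k : separator (e k) = wreath_top G (e i).
Proof. by rewrite /separator (free_homE eH) /= eqxx. Qed.

Lemma separator_conj_basis l :
  separator (e i ^ e l) = wreath_factor1 G (e i) ^ separator (e l).
Proof.
by rewrite (morph_onJ sH separatorM) // separator_basis //; left.
Qed.

Definition separated_coord (l : I) (x : G) : G :=
  (separator (partial_conj e i (e l) x)).2 1.

Lemma separated_coordM l :
  morph_on (generated (e @` (i |` A))) (separated_coord l).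
Proof.
have sepM : morph_on (generated (e @` (i |` A)))
    (separator \o partial_conj e i (e l)).
  apply: sub_morph_on (@free_basis_generated_sub _ _ _ _ eH _) _.
  apply: comp_morph_on (partial_conjM eH _ _) separatorM.
  exact: partial_conj_set_fun.
apply: (comp_morph_on _ sepM (wreath_coordM 1)).
apply: (generated_set_fun sepM (@wreath_base_subgroup _ _)).
move=> _ [z [->|Az] <-] /=.
  by rewrite (partial_conj_basis eH) separator_conj_basis; exact: wreath_baseJ.
by rewrite partial_conj_basis_in // separator_basis //; right.
Qed.

Lemma separated_coord_basis l z : A z -> separated_coord l (e z) = e z.
Proof.
move=> Az; rewrite /separated_coord partial_conj_basis_in //.
by rewrite separator_basis /= ?eqxx //; right.
Qed.

Lemma separated_coord_j_id x :
  generated (e @` (i |` A)) x -> separated_coord j x = x.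
Proof.
apply: (generated_morph_eq (g := id) (separated_coordM j)) => //.
move=> _ [z [->|Az] <-]; last exact: separated_coord_basis.
rewrite /separated_coord (partial_conj_basis eH) separator_conj_basis.
by rewrite separator_basis_j conjg1 /= eqxx.
Qed.

Lemma separated_coord_k_mem x :
  generated (e @` (i |` A)) x -> generated (e @` A) (separated_coord k x).
Proof.
have sA := generated_subgroup (e @` A).
apply: (generated_set_fun (separated_coordM k) sA) => _ [z [->|Az] <-].
  rewrite /separated_coord (partial_conj_basis eH) separator_conj_basis.
  rewrite separator_basis_k wreath_factor1_conj_top /= mulg1.
  by case: eqP => [/(free_basis_neq1 eH)//|_]; case: sA.
by rewrite separated_coord_basis //; apply: sub_generated; exists z.
Qed.

Lemma partial_conj_separates x : generated (e @` (i |` A)) x ->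
  partial_conj e i (e j) x = partial_conj e i (e k) x -> generated (e @` A) x.
Proof.
move=> Ax jkx; rewrite -(separated_coord_j_id Ax) /separated_coord jkx.
exact: separated_coord_k_mem.
Qed.

End Separation.

(** * Elementary substructures and algebraic closure *)

Section SatAutomorphism.
Variables (G : groupType) (H : set G) (h : G -> G).
Hypotheses (sH : is_subgroup H) (hA : aut_on H h).

Lemma teval_mem n (v : 'I_n -> G) t : (forall i, H (v i)) -> H (teval v t).
Proof.
have [H1 HM HV] := sH => Hv.
by elim: t => /= [i||t Ht u Hu|t Ht] //; [exact: HM|exact: HV].
Qed.

Lemma teval_morph n (v : 'I_n -> G) t :
  (forall i, H (v i)) -> teval (h \o v) t = h (teval v t).
Proof.
have [hM _] := hA => Hv; elim: t => //= [|t -> u ->|t ->].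
- by rewrite (morph_on1 sH hM).
- by rewrite hM //; exact: teval_mem.
by rewrite (morph_onV sH hM) //; exact: teval_mem.
Qed.

Lemma sat_aut n (phi : formula n) (v : 'I_n -> G) :
  (forall i, H (v i)) -> sat H phi (h \o v) <-> sat H phi v.
Proof.
have [_ [hH hI hS]] := hA.
elim: phi v => {n} [n t u|n|n p IHp q IHq|n p IHp] v Hv //=.
- rewrite !teval_morph //; split=> [|->//].
  by apply: hI; apply: mem_set; exact: teval_mem.
- by rewrite IHp // IHq.
split=> [p_all x Hx|p_all y /hS[x Hx <-]].
  rewrite -IHp ?scons_comp; last exact: scons_all.
  by apply: p_all; exact: hH.
by rewrite -scons_comp IHp; [exact: p_all|exact: scons_all].
Qed.

End SatAutomorphism.

Lemma elementary_exists (G : groupType) (D D' : set G) n (phi : formula n.+1)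
    (v : 'I_n -> G) :
  elementary_sub D D' -> (forall i, D (v i)) ->
  (exists2 x, D' x & sat D' phi (scons x v)) ->
  exists2 x, D x & sat D phi (scons x v).
Proof.
move=> [_ _ _ elem] Dv [x D'x phix]; apply: contrapT => noD.
pose nphi := FAll (FImp phi FFalse).
have /(elem _ nphi _ Dv) /(_ x D'x phix) // : sat D nphi v.
by move=> y Dy phiy; apply: noD; exists y.
Qed.

Lemma elementary_conj (G : groupType) (D D' : set G) x y g :
  elementary_sub D D' -> D x -> D y -> D' g -> y = x ^ g ->
  exists2 g', D g' & y = x ^ g'.
Proof.
move=> elemD Dx Dy D'g xy; have [[D1 _ _] _ _ _] := elemD.
pose z := TVar (ord0 : 'I_3); pose xvar := TVar (lift ord0 ord0 : 'I_3).
pose yvar := TVar (lift ord0 (lift ord0 ord0) : 'I_3).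
pose v : 'I_2 -> G := scons x (scons y (fun _ : 'I_0 => 1)).
pose phi := FEq yvar (TMul (TInv z) (TMul xvar z)).
have phiP B g' : sat B phi (scons g' v) <-> y = x ^ g'.
  by rewrite /phi /v /= !(scons_lift, scons0) conjgE.
have Dv i : D (v i) by apply: scons_all i => //; exact: scons_all.
have [|g' Dg' /phiP xg'] := elementary_exists (phi := phi) elemD Dv.
  by exists g => //; apply/phiP.
by exists g'.
Qed.

Section Invariance.
Variables (M : groupType) (H : set M).
Hypothesis elemH : elementary_sub H [set: M].

Lemma definable_aut h n (P : ('I_n -> M) -> Prop) (v : 'I_n -> M) :
  definable P -> aut_on H h -> (forall i, H (v i)) -> P (h \o v) <-> P v.
Proof.
have [sH _ _ elem] := elemH => -[phi phiP] hA Hv.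
rewrite !phiP -!elem //; first exact: sat_aut.
by have [_ [hH _ _]] := hA => i; exact: hH.
Qed.

(* As h is an automorphism of H only, it acts on an imaginary element through
   its representatives in H. *)
Definition fixed_elt (h : M -> M) : set (eqelt M) :=
  [set b | exists u : 'I_(width (projT1 b)) -> M,
     [/\ forall i, H (u i), represented u = projT2 b &
         represented (h \o u) = projT2 b]].

Definition aut_fixing (A : set (eqelt M)) : set (M -> M) :=
  [set h | aut_on H h /\ A `<=` fixed_elt h].

Lemma fixed_real h x : H x -> h x = x -> fixed_elt h (real x).
Proof. by move=> Hx hx; exists (fun _ => x). Qed.

Lemma fixed_env h (A : set (eqelt M)) c (r : eqenv c) :
  A `<=` fixed_elt h -> env_in A r ->
  exists v, [/\ forall i, H (v i), crepresented v = r &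
                crepresented (h \o v) = r].
Proof.
move=> fA; elim: c r => [[] _|s c IHc [x r]].
  by exists (fun _ => 1); split => // i; case: elemH => -[].
move=> [/fA[u [Hu ux hux]] /IHc[v [Hv vr hvr]]]; exists (vcat u v).
rewrite -vcat_comp !(crepresented_cat (s := s)) /= ux vr hux hvr.
by split=> //; exact: vcat_all.
Qed.

Lemma definable_over_aut h (A : set (eqelt M)) s (X : set (eqcarrier s)) u :
  aut_on H h -> A `<=` fixed_elt h -> definable_over A X ->
  (forall i, H (u i)) -> X (represented u) -> X (represented (h \o u)).
Proof.
move=> hA fA [c [phi [r [Ar ->]]]] Hu /=.
have [v [Hv vr hvr]] := fixed_env fA Ar.
rewrite -{1}vr -hvr -!crepresented_cat vcat_comp.
by move/(definable_aut (definable_eqsat phi) hA (vcat_all Hu Hv)).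
Qed.

Lemma acleq_finite_orbit (A : set (eqelt M)) s (u : 'I_(width s) -> M) :
  (forall i, H (u i)) -> acleq A (existT (@eqcarrier M) s (represented u)) ->
  finite_set [set represented (h \o u) | h in aut_fixing A].
Proof.
move=> Hu [X /= [Xdef Xfin Xu]]; apply: sub_finite_set Xfin => _ [h [hA fA] <-].
exact: definable_over_aut Xdef Hu Xu.
Qed.

End Invariance.

Lemma acleqS (M : groupType) (A B : set (eqelt M)) :
  A `<=` B -> acleq A `<=` acleq B.
Proof.
move=> AB b [X [[c [phi [r [Ar XE]]]] Xfin Xb]]; exists X; split => //.
exists c, phi, r; split=> //.
by elim: c r {phi XE} Ar => //= s c IHc r [/AB Br /IHc].
Qed.

Section ElementaryFreeSubgroup.
Variables (M : groupType) (H : set M) (I : choiceType) (e : I -> M).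
Hypotheses (elemH : elementary_sub H [set: M]) (eH : free_basis H e).
Variables (A : set I) (i : I).
Hypotheses (niA : ~ A i) (coinfA : infinite_set (~` A)).

Let eHi := free_basis_mem eH.

Lemma free_hom_fixed_elt (f : I -> M) : (forall z, A z -> f z = e z) ->
  [set real x | x in generated (e @` A)] `<=` fixed_elt H (free_hom e f).
Proof.
move=> fe _ [x Ax <-]; apply: fixed_real.
  exact: (free_basis_generated_sub eH Ax).
exact: (free_hom_fix eH fe Ax).
Qed.

Lemma proj_conj_basis_inj j k :
  proj (E := E1 M) (fun _ => e j) = proj (E := E1 M) (fun _ => e k) -> j = k.
Proof.
move=> /proj_eqP[g /= jk].
have [|g' Hg' jk'] := elementary_conj elemH (eHi _) (eHi _) _ jk; first by [].
by rewrite (free_basis_conj_inj eH Hg' jk').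
Qed.

Lemma transposition_fixing k : ~ A k ->
  aut_fixing H [set real x | x in generated (e @` A)]
    (free_hom e (e \o transposition i k)).
Proof.
have trK := transpositionK i k.
move=> nkA; split; first exact: (free_hom_perm_aut eH trK trK).
apply: free_hom_fixed_elt => z Az.
by rewrite /= transpositionD //; apply/eqP => zE; subst z.
Qed.

Lemma conj_class_notin_acleq :
  ~ acleq [set real x | x in generated (e @` A)] (conj_class (e i)).
Proof.
pose h k := free_hom e (e \o transposition i k).
pose class k := proj (E := E1 M) (fun _ => e k).
have hi k : proj (E := E1 M) (h k \o (fun _ => e i)) = class k.
  congr proj; apply: funext => z.
  by rewrite /= /h (free_homE eH) /= transpositionL.
move=> /(@acleq_finite_orbit _ _ elemH _ (Quot (E1 M)) (fun _ => e i)).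
move=> /(_ (fun=> eHi i)) orbit_fin; apply: coinfA.
apply: (finite_set_inj (f := class) orbit_fin) => [k nAk|j k _ _]; last first.
  exact: proj_conj_basis_inj.
by exists (h k); [exact: transposition_fixing|exact: hi].
Qed.

Lemma partial_conj_fixing g : generated (e @` [set~ i]) g ->
  aut_fixing H ([set real x | x in generated (e @` A)] `|`
                [set conj_class (e i)]) (partial_conj e i g).
Proof.
move=> gi; split; first exact: (partial_conj_aut eH gi).
rewrite subUset; split=> [|_ ->].
  apply: free_hom_fixed_elt => z Az /=.
  by case: eqP => // zi; subst z.
exists (fun _ => e i); split=> //=; apply/proj_eqP/conj_rel_sym.
by exists g; rewrite /= (partial_conj_basis eH).
Qed.

Lemma acleq_conj_class_generated x : generated (e @` (i |` A)) x ->
  acleq ([set real x | x in generated (e @` A)] `|` [set conj_class (e i)])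
    (real x) ->
  generated (e @` A) x.
Proof.
move=> iAx /(@acleq_finite_orbit _ _ elemH _ (Home M) (fun _ => x)).
move=> /(_ (fun=> free_basis_generated_sub eH iAx)) orbit_fin.
apply: contrapT => nAx.
have infJ : infinite_set (~` (i |` A)).
  by rewrite setCU setIC; apply: infinite_setD coinfA (finite_set1 i).
pose hx k := partial_conj e i (e k) x.
apply: infJ; apply: (finite_set_inj (f := hx) orbit_fin) => [k nkA|j k].
  exists (partial_conj e i (e k)) => //; apply: partial_conj_fixing.
  by apply: sub_generated; exists k => // ki; apply: nkA; left.
move=> /set_mem njA /set_mem nkA hjk; apply/eqP/negPn/negP => njk; apply: nAx.
exact: (partial_conj_separates eH niA njA nkA njk iAx hjk).
Qed.

End ElementaryFreeSubgroup.

Theorem theoremA1 (M : groupType) (e : nat -> M) (hM : ambient_model e)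
    (n : nat) (hn : (2 <= n)%N)
    (m : nat) (a : 'I_m -> M) (ha : forall i, Fk e n.+1 (a i)) :
  ~ ((forall i,
        acleq ([set real x | x in Fk e n] `|` [set conj_class (e n)])
          (real (a i))) /\
     acleq ([set real x | x in Fk e n] `|` [set real (a i) | i in [set: 'I_m]])
       (conj_class (e n))).
Proof.
have elemF := am_elementary hM; have eF := am_basis hM.
have nIn : ~ `I_n n by rewrite /= ltnn.
have coinfIn : infinite_set (~` `I_n).
  by rewrite -setTD; exact: infinite_setD infinite_nat (finite_II n).
have FnS : Fk e n.+1 `<=` generated (e @` (n |` `I_n)).
  apply: generatedS; apply: image_subset => i /=.
  by rewrite ltnS leq_eqVlt => /predU1P.
case=> acl_a acl_class.
have Fn_a i : Fk e n (a i).
  exact: (acleq_conj_class_generated elemF eF nIn coinfIn (FnS _ (ha i))).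
apply: (conj_class_notin_acleq elemF eF nIn coinfIn).
apply: acleqS acl_class; rewrite subUset; split=> // _ [i _ <-].
by exists (a i); first exact: Fn_a.
Qed.
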